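(* The linear transformation $W:\Lambda^k\mathcal P_n\to\mathcal P_{k\ell}$ determined by $p_1\wedge\cdots\wedge p_k\mapsto W(p_1,\dots,p_k)$ is $\mathrm{SL}_2\mathbb C$-equivariant. That is, for all $a,b,c,d\in\mathbb C$ with $ad-bc=1$ and all $p_1,\dots,p_k\in\mathcal P_n$, setting $\hat p_i(\hat z)=(c\hat z+d)^n p_i(z)$ with $z=\frac{a\hat z+b}{c\hat z+d}$, one has $$W(\hat p_1,\dots,\hat p_k)(\hat z)=(c\hat z+d)^{k\ell}\,W(p_1,\dots,p_k)(z).$$
   Context: Work over $\mathbb C$. $\mathcal P_m$ is the vector space of polynomials in $z$ of degree $\le m$. Fix integers $n\ge0$, $1\le k\le n+1$, and put $\ell=n+1-k$. The Wronskian is $W(p_1,\dots,p_k)=\det(p_i^{(j-1)})_{1\le i,j\le k}$; for $p_i\in\mathcal P_n$ it has degree $\le k\ell$, and it is multilinear and alternating, so it defines a linear map $\Lambda^k\mathcal P_n\to\mathcal P_{k\ell}$. The group $\mathrm{SL}_2\mathbb C$ acts on $\mathcal P_m$ by $p(z)\mapsto\hat p(\hat z)=(c\hat z+d)^m p\!\left(\frac{a\hat z+b}{c\hat z+d}\right)$, and on $\Lambda^k\mathcal P_n$ by the induced action. *)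

(* Defs.v *)
From HB Require Import structures.
From mathcomp Require Import all_boot all_order perm all_algebra.
From mathcomp Require Import boolp reals complex.
From mathcomp Require Import finmap monalg.
From mathcomp Require Import zify ring.

Set Implicit Arguments.
Unset Strict Implicit.
Unset Printing Implicit Defensive.

Import GRing.Theory.
Local Open Scope ring_scope.
Local Open Scope quotient_scope.

Section AlternatingMaps.
Variables (K : fieldType) (V : lmodType K) (k : nat).

Definition ffun_upd (v : {ffun 'I_k -> V}) (i : 'I_k) (x : V) :
  {ffun 'I_k -> V} := [ffun j => if j == i then x else v j].

Definition multilinear_map (U : lmodType K) (f : {ffun 'I_k -> V} -> U) :=
  forall v i (a : K) (x y : V),
    f (ffun_upd v i (a *: x + y)) = a *: f (ffun_upd v i x) + f (ffun_upd v i y).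

Definition alternating_map (U : lmodType K) (f : {ffun 'I_k -> V} -> U) :=
  forall (v : {ffun 'I_k -> V}) (i j : 'I_k), i != j -> v i = v j -> f v = 0.

Record altmap (U : lmodType K) := AltMap {
  altmap_fun :> {ffun 'I_k -> V} -> U;
  altmap_multilinear : multilinear_map altmap_fun;
  altmap_alternating : alternating_map altmap_fun
}.

End AlternatingMaps.

(* The exterior power is the free module on k-tuples of vectors modulo the    *)
(* submodule generated by the multilinearity and alternation relations.       *)
Section ExteriorPower.
Variables (K : fieldType) (V : lmodType K) (k : nat).

Local Notation free := {malg K[{ffun 'I_k -> V}]}.
Local Notation gen v := (mkmalgU v 1 : free).

Inductive ext_rel : free -> Prop :=
| ext_rel0 : ext_rel 0
| ext_relP (a : K) x y : ext_rel x -> ext_rel y -> ext_rel (a *: x + y)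
| ext_rel_linear v i (a : K) (x y : V) :
    ext_rel (gen (ffun_upd v i (a *: x + y))
             - (a *: gen (ffun_upd v i x) + gen (ffun_upd v i y)))
| ext_rel_alt (v : {ffun 'I_k -> V}) (i j : 'I_k) : i != j -> v i = v j -> ext_rel (gen v).

Definition ext_pred (x : free) : bool := `[< ext_rel x >].

Fact ext_pred_submod : submod_closed ext_pred.
Proof.
split=> [|a x y]; first exact/asboolP/ext_rel0.
by move=> /asboolP hx /asboolP hy; apply/asboolP/ext_relP.
Qed.

HB.instance Definition _ :=
  GRing.isSubmodClosed.Build K free ext_pred ext_pred_submod.

Definition extpow := Quotient.quot (GRing.ZmodClosed.clone free ext_pred _).

HB.instance Definition _ := GRing.Zmodule.on extpow.
HB.instance Definition _ := EqQuotient.on extpow.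

Definition wedge (v : {ffun 'I_k -> V}) : extpow := \pi_extpow (gen v).

Lemma ext_piE (x y : free) : ext_rel (x - y) <-> \pi_extpow x = \pi_extpow y.
Proof.
split=> [h|/eqP].
  by apply/eqP; rewrite -Quotient.idealrBE; apply/asboolP.
by rewrite -Quotient.idealrBE => /asboolP.
Qed.

Lemma ext_piD (x y : free) :
  \pi_extpow (x + y) = \pi_extpow x + \pi_extpow y.
Proof. exact: (@Quotient.pi_add free (GRing.ZmodClosed.clone free ext_pred _)). Qed.

Definition ext_scale (a : K) (x : extpow) : extpow := \pi_extpow (a *: repr x).

Lemma ext_piZ (a : K) (x : free) :
  \pi_extpow (a *: x) = ext_scale a (\pi_extpow x).
Proof.
apply/ext_piE; rewrite -scalerBr -[_ *: _]addr0.
by apply: ext_relP; [apply/ext_piE; rewrite reprK | exact: ext_rel0].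
Qed.

Fact ext_scalerA (a b : K) (x : extpow) :
  ext_scale a (ext_scale b x) = ext_scale (a * b) x.
Proof. by elim/quotW: x => x; rewrite -(ext_piZ b) -!ext_piZ scalerA. Qed.

Fact ext_scale1r (x : extpow) : ext_scale 1 x = x.
Proof. by elim/quotW: x => x; rewrite -!ext_piZ scale1r. Qed.

Fact ext_scalerDr (a : K) (x y : extpow) :
  ext_scale a (x + y) = ext_scale a x + ext_scale a y.
Proof.
elim/quotW: x => x; elim/quotW: y => y.
by rewrite -ext_piD -!ext_piZ -ext_piD scalerDr.
Qed.

Fact ext_scalerDl (x : extpow) (a b : K) :
  ext_scale (a + b) x = ext_scale a x + ext_scale b x.
Proof. by elim/quotW: x => x; rewrite -!ext_piZ -ext_piD scalerDl. Qed.

HB.instance Definition _ := GRing.Zmodule_isLmodule.Build K extpow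
  ext_scalerA ext_scale1r ext_scalerDr ext_scalerDl.

Fact ext_pi_linear : linear (\pi_extpow : free -> extpow).
Proof. by move=> a x y; rewrite ext_piD ext_piZ. Qed.

Lemma wedge_multilinear : multilinear_map wedge.
Proof.
move=> v i a x y; rewrite /wedge -ext_pi_linear.
by apply/ext_piE/ext_rel_linear.
Qed.

Lemma wedge_alternating : alternating_map wedge.
Proof.
move=> v i j ij vij; rewrite /wedge.
have -> : (0 : extpow) = \pi_extpow (0 : free).
  by apply: (addrI (\pi_extpow 0)); rewrite -ext_piD !addr0.
by apply/ext_piE; rewrite subr0; apply: ext_rel_alt vij.
Qed.

Section Lift.
Variable U : lmodType K.

Definition free_lift (f : {ffun 'I_k -> V} -> U) (x : free) : U :=
  \sum_(v <- msupp x) x@_v *: f v.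

Lemma free_liftEw f (x : free) (d : {fset {ffun 'I_k -> V}}) :
  fsubset (msupp x) d -> free_lift f x = \sum_(v <- d) x@_v *: f v.
Proof.
move=> /fsubsetP sub; rewrite /free_lift.
rewrite (bigID (fun v => v \in msupp x) (r := d)) /= [X in _ + X]big1 ?addr0.
  rewrite -[RHS]big_filter; apply: perm_big; apply: uniq_perm.
  - exact: fset_uniq.
  - by rewrite filter_uniq ?fset_uniq.
  by move=> v; rewrite mem_filter; case: (boolP (v \in msupp x)) => // /sub ->.
by move=> v; rewrite -mcoeff_eq0 => /eqP ->; rewrite scale0r.
Qed.

Lemma free_lift_linear f : linear (free_lift f).
Proof.
move=> a x y.
pose d := fsetU (msupp x) (msupp y).
have sx : fsubset (msupp x) d by exact: fsubsetUl.
have sy : fsubset (msupp y) d by exact: fsubsetUr.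
have sz : fsubset (msupp (a *: x + y)) d.
  apply: fsubset_trans (msuppD_le _ _) _; apply: fsetSU; exact: msuppZ_le.
rewrite (free_liftEw _ sx) (free_liftEw _ sy) (free_liftEw _ sz).
rewrite scaler_sumr -big_split /=; apply: eq_bigr => v _.
by rewrite mcoeffD mcoeffZ scalerDl scalerA.
Qed.

HB.instance Definition _ f := GRing.isLinear.Build K free U _ (free_lift f)
  (free_lift_linear f).

Lemma free_lift_gen f v : free_lift f (gen v) = f v.
Proof.
rewrite (@free_liftEw _ _ [fset v]%fset) ?msuppU_le //.
by rewrite big_seq_fset1 mcoeffUU scale1r.
Qed.

Variable f : altmap V k U.

Lemma free_lift_rel (x : free) : ext_rel x -> free_lift f x = 0.
Proof.
elim=> [|a y z _ hy _ hz|v i a y z|v i j ij vij].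
- by rewrite linear0.
- by rewrite linearP /= hy hz scaler0 addr0.
- rewrite linearB linearP /= !free_lift_gen altmap_multilinear.
  by rewrite subrr.
- by rewrite free_lift_gen (altmap_alternating f ij vij).
Qed.

Definition ext_lift (x : extpow) : U := free_lift f (repr x).

Lemma ext_lift_pi (x : free) : ext_lift (\pi_extpow x) = free_lift f x.
Proof.
apply/eqP; rewrite -subr_eq0 /ext_lift -linearB /=; apply/eqP.
by apply: free_lift_rel; apply/ext_piE; rewrite reprK.
Qed.

Fact ext_lift_is_linear : linear ext_lift.
Proof.
move=> a x y; elim/quotW: x => x; elim/quotW: y => y.
by rewrite -ext_pi_linear !ext_lift_pi linearP.
Qed.

HB.instance Definition _ := GRing.isLinear.Build K extpow U _ ext_lift
  ext_lift_is_linear.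

Lemma ext_liftE v : ext_lift (wedge v) = f v.
Proof. by rewrite ext_lift_pi free_lift_gen. Qed.

End Lift.

Lemma eq_on_wedge (U : lmodType K) (f g : {linear extpow -> U}) :
  (forall v, f (wedge v) = g (wedge v)) -> f =1 g.
Proof.
move=> fg; elim/quotW=> x.
pose F := GRing.isLinear.Build _ _ _ _ _ ext_pi_linear.
pose L : {linear free -> extpow} := HB.pack (\pi_extpow : free -> extpow) F.
rewrite -[\pi_extpow x]/(L x) [x]monalgE !linear_sum /=.
apply: eq_bigr => v _.
have -> : mkmalgU v (x@_v) = x@_v *: gen v.
  by apply/malgP=> w; rewrite mcoeffZ !mcoeffU mulrnAr mulr1.
have E : \pi_extpow (x@_v *: gen v) = x@_v *: wedge v := ext_piZ _ _.
by rewrite E !linearZ /= fg.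
Qed.

End ExteriorPower.

Section ExteriorMap.
Variables (K : fieldType) (V U : lmodType K) (k : nat) (f : {linear V -> U}).

Definition wedge_map (v : {ffun 'I_k -> V}) : extpow U k :=
  wedge [ffun i => f (v i)].

Lemma map_upd v i x :
  [ffun j => f (ffun_upd v i x j)] = ffun_upd [ffun j => f (v j)] i (f x)
  :> {ffun 'I_k -> U}.
Proof. by apply/ffunP=> j; rewrite !ffunE; case: ifP. Qed.

Fact wedge_map_multilinear : multilinear_map wedge_map.
Proof.
by move=> v i a x y; rewrite /wedge_map !map_upd linearP wedge_multilinear.
Qed.

Fact wedge_map_alternating : alternating_map wedge_map.
Proof.
by move=> v i j ij vij; apply: (wedge_alternating ij); rewrite !ffunE vij.
Qed.

Definition ext_map : {linear extpow V k -> extpow U k} :=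
  ext_lift (AltMap wedge_map_multilinear wedge_map_alternating).

Lemma ext_mapE v : ext_map (wedge v) = wedge [ffun i => f (v i)].
Proof. exact: ext_liftE. Qed.

End ExteriorMap.

Section Wronskian.
Variable K : fieldType.

Definition wronskian k (p : 'I_k -> {poly K}) : {poly K} :=
  \det (\matrix_(i < k, j < k) (p i)^`(j)).

Lemma injective_sum_ge k (g : 'I_k -> nat) :
  injective g -> (k * k.-1 <= (\sum_i g i).*2)%N.
Proof.
move=> inj_g.
have below i : (\sum_j (g j < g i)%N <= g i)%N.
  rewrite -big_mkcond /= sum1dep_card cardE -(size_map g) -[leqRHS](size_iota 0).
  apply: uniq_leq_size; first by rewrite map_inj_uniq ?enum_uniq.
  by move=> y /mapP[j]; rewrite mem_enum inE => ltj ->; rewrite mem_iota.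
rewrite -addnn; apply: (@leq_trans (\sum_i \sum_j (g j < g i) +
                                    \sum_i \sum_j (g j < g i))%N); last first.
  by apply: leq_add; apply: leq_sum => i _; apply: below.
rewrite [X in (_ <= _ + X)%N]exchange_big -big_split /=.
under eq_bigr => i _ do rewrite -big_split /=.
have row (i : 'I_k) : (\sum_(j < k) ((g j < g i) + (g i < g j)) = k.-1)%N.
  rewrite (bigD1 i) //= ltnn add0n (eq_bigr (fun=> 1%N)) => [|j ji].
    by rewrite sum1_card cardC1 card_ord.
  have : g j != g i by rewrite (inj_eq inj_g).
  by case: ltngtP.
by rewrite (eq_bigr _ (fun i _ => row i)) sum_nat_const card_ord.
Qed.

Lemma size_derivnXn e j (q := ('X^e)^`(j) : {poly K}) :
  q != 0 -> (j <= e)%N /\ (size q <= (e - j).+1)%N.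
Proof.
rewrite /q derivnXn; case: (leqP j e) => [le_je _|lt_ej].
  split=> //; rewrite -scaler_nat.
  by apply: leq_trans (size_scale_leq _ _) _; rewrite size_polyXn.
by rewrite ffact_small // mulr0n eqxx.
Qed.

Lemma size_prod_leqS (I : finType) (F : I -> {poly K}) (d : I -> nat) :
  (forall i, (size (F i) <= (d i).+1)%N) ->
  (size (\prod_i F i)%R <= (\sum_i d i).+1)%N.
Proof.
move=> le_d; pose P (p : {poly K}) m := (size p <= m.+1)%N.
apply: (@big_ind2 _ _ P _ _ _ _ _ _ _ (index_enum I) xpredT F d); rewrite /P.
- by rewrite size_poly1.
- move=> p m q m' hp hq; apply: leq_trans (size_polyMleq _ _) _; lia.
- by move=> i _; apply: le_d.
Qed.

Lemma size_wronskianXn n k (e : 'I_k -> nat) :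
  (forall i, (e i <= n)%N) ->
  (size (wronskian (fun i => 'X^(e i))) <= (k * (n.+1 - k)).+1)%N.
Proof.
move=> le_en; have [inj_e|] := boolP (injectiveb e); last first.
  case/injectivePn=> i [j ij eij].
  rewrite /wronskian (@determinant_alternate _ _ _ i j) ?size_poly0 //.
  by move=> l; rewrite !mxE eij.
move/injectiveP: inj_e => inj_e.
have inj_co : injective (fun i => n - e i)%N.
  move=> i j eq_ij; apply: inj_e.
  by have := le_en i; have := le_en j; lia.
have sum_co : (\sum_i (n - e i) + \sum_i e i = k * n)%N.
  rewrite -big_split /= (eq_bigr (fun=> n)) => [|i _]; last by rewrite subnK.
  by rewrite sum_nat_const card_ord.
have sum_id (s : {perm 'I_k}) : ((\sum_i s i)%N.*2 = k * k.-1)%N.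
  have <- : (\sum_(i < k) i = \sum_i s i)%N by rewrite (reindex_inj (@perm_inj _ s)).
  have -> : (\sum_(i < k) i = 'C(k, 2))%N by rewrite -bin2_sum big_mkord.
  by rewrite bin2 -[RHS]odd_double_half oddM; case: (k) => //= m; rewrite andNb.
have ge_co := injective_sum_ge inj_co.
rewrite /wronskian /determinant; apply: leq_trans (size_sum _ _ _) _.
apply/bigmax_leqP => s _.
rewrite -signr_odd; set t := \prod_i _.
have -> : size ((-1) ^+ odd s * t) = size t.
  by case: (odd s); rewrite ?expr1 ?mulN1r ?size_polyN ?expr0 ?mul1r.
have [t0|t_neq0] := eqVneq t 0; first by rewrite t0 size_poly0.
have entry i : (s i <= e i)%N /\ (size (('X^(e i))^`(s i) : {poly K}) <= (e i - s i).+1)%N.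
  apply: size_derivnXn; move: t_neq0; rewrite prodf_seq_neq0.
  by move=> /allP/(_ i); rewrite mem_index_enum mxE => /(_ isT).
apply: leq_trans (_ : (\sum_i (e i - s i)).+1 <= _)%N.
  by apply: size_prod_leqS => i; rewrite mxE; case: (entry i).
have sum_sub : (\sum_i (e i - s i) + \sum_i s i = \sum_i e i)%N.
  by rewrite -big_split /=; apply: eq_bigr => i _; rewrite subnK //; case: (entry i).
rewrite ltnS; have ge_e := injective_sum_ge inj_e.
move: (sum_id s) ge_co ge_e sum_co sum_sub.
move: (\sum_i (e i - s i))%N (\sum_i s i)%N (\sum_i e i)%N (\sum_i (n - e i))%N.
case: (k) => [|m] A S E D /= eS geD geE eDE eAS; first by nia.
have [l def_n] : exists l, n = (m + l)%N by exists (n - m)%N; nia.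
by move: eDE; rewrite subSS def_n addKn; nia.
Qed.

Lemma wronskian_sumXn n k (p : 'I_k -> {poly_n K}) :
  wronskian (fun i => p i : {poly K}) =
  \sum_(f : {ffun 'I_k -> 'I_n})
    (\prod_i (p i)`_(f i)) *: wronskian (fun i => 'X^(f i)).
Proof.
rewrite /wronskian /determinant.
under [RHS]eq_bigr => f _ do rewrite scaler_sumr.
rewrite exchange_big; apply: eq_bigr => s _ /=.
under [RHS]eq_bigr => f _ do rewrite scalerAr.
rewrite -mulr_sumr; congr (_ * _).
have expand (q : {poly_n K}) j :
    (q : {poly K})^`(j) = \sum_(e < n) q`_e *: ('X^e)^`(j).
  have {1}-> : q = \poly_(l < n) q`_l :> {poly K}.
    by apply/polyP=> l; rewrite coef_poly; case: ltnP => // /big_coef_npoly.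
  by rewrite poly_def raddf_sum; apply: eq_bigr => e _; rewrite /= derivnZ.
under eq_bigr => i _ do rewrite mxE expand.
rewrite bigA_distr_bigA /=; apply: eq_bigr => f _.
by rewrite -scaler_prod; apply: eq_bigr => i _; rewrite mxE.
Qed.

Lemma size_wronskian n k (p : 'I_k -> {poly_n.+1 K}) :
  (size (wronskian (fun i => p i : {poly K})) <= (k * (n.+1 - k)).+1)%N.
Proof.
rewrite wronskian_sumXn; apply: leq_trans (size_sum _ _ _) _.
apply/bigmax_leqP => f _; apply: leq_trans (size_scale_leq _ _) _.
by apply: size_wronskianXn => i; rewrite -ltnS.
Qed.

Definition wronskian_map n k (p : {ffun 'I_k -> {poly_n.+1 K}}) :
  {poly_(k * (n.+1 - k)).+1 K} := NPoly (size_wronskian p).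

Fact wronskian_multilinear n k : multilinear_map (@wronskian_map n k).
Proof.
move=> v i a x y; apply: val_inj; rewrite /= /wronskian.
set A := \matrix_(_, _) _; set B := \matrix_(_, _) _; set C := \matrix_(_, _) _.
rewrite (@determinant_multilinear _ _ A B C i a%:P 1) ?mul1r ?mul_polyC //.
- by apply/rowP=> j; rewrite !mxE !ffunE !eqxx mul1r mul_polyC derivnD derivnZ.
- by apply/matrixP=> l j; rewrite !mxE !ffunE eq_sym (negPf (neq_lift _ _)).
- by apply/matrixP=> l j; rewrite !mxE !ffunE eq_sym (negPf (neq_lift _ _)).
Qed.

Fact wronskian_alternating n k : alternating_map (@wronskian_map n k).
Proof.
move=> v i j ij vij; apply: val_inj; rewrite /= /wronskian.
by apply: (determinant_alternate ij) => l; rewrite !mxE vij.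
Qed.

(* W : /\^k P_n -> P_(k l), with l = n + 1 - k and P_m = {poly_m.+1 K}.       *)
Definition ext_wronskian n k :
    {linear extpow {poly_n.+1 K} k -> {poly_(k * (n.+1 - k)).+1 K}} :=
  ext_lift (AltMap (@wronskian_multilinear n k) (@wronskian_alternating n k)).

Lemma ext_wronskianE n k (p : {ffun 'I_k -> {poly_n.+1 K}}) :
  ext_wronskian n k (wedge p) = wronskian (fun i => p i : {poly K}) :> {poly K}.
Proof. by rewrite /ext_wronskian /= ext_liftE. Qed.

End Wronskian.

Section SL2Action.
Variables (K : fieldType) (m : nat) (a b c d : K).

(* The polynomial (c z + d)^m p((a z + b) / (c z + d)), denominators cleared. *)
Definition sl2_poly (p : {poly_m.+1 K}) : {poly K} :=
  \sum_(i < m.+1)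
    p`_i *: ((a *: 'X + b%:P) ^+ i * (c *: 'X + d%:P) ^+ (m - i)).

Fact size_sl2_poly p : (size (sl2_poly p) <= m.+1)%N.
Proof.
have size_lin (x y : K) i : (size ((x *: 'X + y%:P) ^+ i)%R <= i.+1)%N.
  have le2 : (size (x *: 'X + y%:P)%R <= 2)%N.
    apply: leq_trans (size_polyD _ _) _; rewrite geq_max size_polyC.
    rewrite (leq_trans (size_scale_leq _ _)) ?size_polyX //.
    by case: (y != 0).
  elim: i => [|i IHi]; first by rewrite expr0 size_poly1.
  rewrite exprS; apply: leq_trans (size_polyMleq _ _) _.
  by move: le2 IHi; lia.
apply: leq_trans (size_sum _ _ _) _; apply/bigmax_leqP => i _.
apply: leq_trans (size_scale_leq _ _) _; apply: leq_trans (size_polyMleq _ _) _.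
have := size_lin a b i; have := size_lin c d (m - i)%N; have := ltn_ord i.
by lia.
Qed.

Definition sl2_fun (p : {poly_m.+1 K}) : {poly_m.+1 K} :=
  NPoly (size_sl2_poly p).

Fact sl2_fun_linear : linear sl2_fun.
Proof.
move=> x p q; apply: val_inj; rewrite /= /sl2_poly scaler_sumr -big_split /=.
by apply: eq_bigr => i _; rewrite coefD coefZ scalerDl scalerA.
Qed.

HB.instance Definition _ := GRing.isLinear.Build K {poly_m.+1 K} {poly_m.+1 K}
  _ sl2_fun sl2_fun_linear.

Definition sl2_act : {linear {poly_m.+1 K} -> {poly_m.+1 K}} := sl2_fun.

Lemma horner_sl2_act p z : c * z + d != 0 ->
  (sl2_act p).[z] = (c * z + d) ^+ m * p.[(a * z + b) / (c * z + d)].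
Proof.
move=> nz; rewrite /= /sl2_poly horner_sum (@horner_coef_wide _ m.+1) //.
rewrite mulr_sumr; apply: eq_bigr => i _.
have nzi : (c * z + d) ^+ i != 0 by rewrite expf_neq0.
have split_pow : (c * z + d) ^+ m = (c * z + d) ^+ (m - i) * (c * z + d) ^+ i.
  by rewrite -exprD subnK // -ltnS.
by rewrite !(hornerE, horner_exp) expr_div_n /= split_pow; field.
Qed.

End SL2Action.

(* Main.v *)
Require Import Defs.
From mathcomp Require Import all_boot all_order all_algebra.
From mathcomp Require Import reals complex.
From mathcomp Require Import zify ring.

Import GRing.Theory.
Local Open Scope ring_scope.

(** Write u = c z + d and w = (a z + b) / u, so that dw/dz = u^-2 because
    a d - b c = 1. Differentiating f(z) = u^n q(w) repeatedly, the chain and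
    product rules give
      f^(j)(z) = \sum_(l <= j) t_{jl} u^(n - j - l) q^(l)(w),
    where the t_{jl} are constants that depend on c, n, j and l but not on q,
    and t_{jj} = 1. Hence the Wronskian matrix of the transformed polynomials
    at z is that of the original ones at w times an upper triangular matrix
    with diagonal entries u^(n - 2j), 0 <= j < k, and taking determinants
    produces the factor u^(kn - k(k-1)) = u^(k(n + 1 - k)).

    The exponents n - j - l may be negative, so the computation is arranged to
    stay inside polynomials: [mobius_subst m q] stands for u^m q(w), and the
    formula is multiplied by u^j, which turns it into
      u^j f^(j) = \sum_(l <= j) t_{jl} (u^(n - l) q^(l)(w))
    ([derivn_mobius_subst], obtained by iterating the first-order case
    [deriv_mobius_subst]). Its determinantal form is
    [wronskian_mobius_subst]; evaluating that at a point where u is nonzero and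
    cancelling the powers of u gives [horner_wronskian_mobius_subst].

    The pointwise hypothesis on the transformed polynomials determines them,
    since two polynomials that agree off the zero of u are equal
    ([poly_eq_off_affine_root]). Equivariance on the exterior power then only
    has to be checked on decomposable wedges, where it is the pointwise
    formula. *)

Lemma size_derivn_leq (K : fieldType) (q : {poly K}) l :
  (size q^`(l) <= size q - l)%N.
Proof.
elim: l => [|l IHl]; first by rewrite subn0.
rewrite derivnS subnS.
have [->|nz] := eqVneq q^`(l) 0; first by rewrite deriv0 size_poly0.
by have := lt_size_deriv nz; lia.
Qed.

Section Homogenization.
Context {K : fieldType}.
Variables (a b c d : K).

Local Notation num := (a *: 'X + b%:P : {poly K}).
Local Notation den := (c *: 'X + d%:P : {poly K}).

(** This is u^m q((a z + b) / u) with u = c z + d, denominators cleared. It is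
    defined on all polynomials rather than on those of degree at most m so
    that m can drop while q is differentiated. *)
Definition mobius_subst (m : nat) (q : {poly K}) : {poly K} :=
  \sum_(i < m.+1) q`_i *: (num ^+ i * den ^+ (m - i)).

Lemma horner_mobius_subst m (q : {poly K}) z :
    (size q <= m.+1)%N -> c * z + d != 0 ->
  (mobius_subst m q).[z] = (c * z + d) ^+ m * q.[(a * z + b) / (c * z + d)].
Proof. by move=> le_qm; apply: (@horner_sl2_act K m a b c d (NPoly le_qm)). Qed.

Lemma deriv_affine (x y : K) : (x *: 'X + y%:P)^`() = x%:P.
Proof. by rewrite derivD derivZ derivX derivC addr0 alg_polyC. Qed.

Hypothesis det1 : a * d - b * c = 1.

Lemma num_den : a%:P * den = c%:P * num + 1.
Proof.
by rewrite -(polyC1 K) -det1 -!mul_polyC polyCB !polyCM; ring.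
Qed.

Lemma mulr_expr_predn (p : {poly K}) r : p * (p ^+ r.-1 *+ r) = p ^+ r *+ r.
Proof. by case: r => [|r]; rewrite ?mulr0n ?mulr0 //= mulrnAr -exprS. Qed.

(** Multiplied by u, this is the product rule
    (u^(m+1) q(w))' = (m+1) c u^m q(w) + u^(m+1) q'(w) u^-2. On the term
    A^i u^(m + 1 - i), where A = a z + b, it amounts to [num_den]. *)
Lemma deriv_mobius_subst m q :
  den * (mobius_subst m.+1 q)^`() =
  (c *+ m.+1) *: mobius_subst m.+1 q + mobius_subst m q^`().
Proof.
(* The second term of the right-hand side, reindexed by the exponent in q
   instead of the exponent in the derivative of q. *)
pose shifted (i : 'I_m.+2) : {poly K} :=
  q`_i *: ((num ^+ i.-1 *+ i) * den ^+ (m.+1 - i)).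
have -> : mobius_subst m q^`() = \sum_i shifted i.
  rewrite [RHS]big_ord_recl {1}/shifted mulr0n mul0r scaler0 add0r.
  apply: eq_bigr => i _.
  by rewrite /shifted coef_deriv mulrnAl -scalerMnl -scalerMnr /= subSS.
rewrite /mobius_subst raddf_sum mulr_sumr scaler_sumr -big_split /=.
apply: eq_bigr => i _; rewrite /shifted derivZ -scalerAr scalerA.
rewrite [_ * q`_i]mulrC -scalerA -scalerDr; congr (_ *: _).
rewrite derivM !deriv_exp !deriv_affine -(mul_polyC (c *+ _)) polyCMn.
have: (i + (m.+1 - i) = m.+1)%N by rewrite subnKC // -ltnS.
move: (nat_of_ord i) (m.+1 - i)%N => r s <-.
have nd := num_den.
have Er := mulr_expr_predn num r; have Es := mulr_expr_predn den s.
(* Generalizing the powers of exponent r.-1 and s.-1 together with their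
   multiplicities avoids splitting off the cases r = 0 and s = 0. *)
rewrite -![_ * _ *+ _]mulrnAr mulrnDr.
move: (num ^+ r.-1 *+ r) (den ^+ s.-1 *+ s) Er Es => E F Er Es.
transitivity (E * (a%:P * den) * den ^+ s + c%:P * num ^+ r * (den * F)).
  by ring.
rewrite nd Es.
transitivity (c%:P * (num * E) * den ^+ s + E * den ^+ s
   + c%:P * num ^+ r * (den ^+ s *+ s)); first by ring.
by rewrite Er; ring.
Qed.

(** The constants t_{jl}. The recursion comes from
    u (u^j f^(j))' = j c u^j f^(j) + u^(j+1) f^(j+1): the l-th term of
    u^j f^(j) keeps its index l with the factor (n - l) c - j c, and moves to
    index l + 1 with the factor 1. *)
Fixpoint deriv_weight (n j l : nat) : K :=
  if j is j'.+1 then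
    (c * ((n - l)%:R - j'%:R)) * deriv_weight n j' l
    + (if l is l'.+1 then deriv_weight n j' l' else 0)
  else (l == 0%N)%:R.

Lemma deriv_weight_gt n j l : (j < l)%N -> deriv_weight n j l = 0.
Proof.
elim: j l => [|j IHj] [|l] //= lt_jl.
by rewrite !IHj ?mulr0 ?addr0 // ltnW.
Qed.

Lemma deriv_weight_diag n j : deriv_weight n j j = 1.
Proof. by elim: j => [|j IHj] //=; rewrite deriv_weight_gt // IHj mulr0 add0r. Qed.

(** The bound on j ensures that every l that occurs before the last
    differentiation is less than n, so that [deriv_mobius_subst] applies with
    m + 1 = n - l; at degree 0 its analogue would fail. *)
Lemma derivn_mobius_subst n q j : (j <= n)%N ->
  den ^+ j * (mobius_subst n q)^`(j) =
  \sum_(l < j.+1) deriv_weight n j l *: mobius_subst (n - l) q^`(l).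
Proof.
elim: j => [|j IHj] lt_jn.
  by rewrite big_ord1 /= scale1r subn0 expr0 mul1r.
have step : den ^+ j.+1 * (mobius_subst n q)^`(j.+1) =
    den * (den ^+ j * (mobius_subst n q)^`(j))^`()
    - (c *+ j) *: (den ^+ j * (mobius_subst n q)^`(j)).
  rewrite derivM deriv_exp deriv_affine -derivnS exprS -mulrnAr.
  rewrite -(mul_polyC (c *+ _)) polyCMn.
  have Ej := mulr_expr_predn den j.
  set f := _^`(j); set g := _^`(j.+1).
  rewrite mulrDr -!mulrA [den * (c%:P * _)]mulrCA [den * (_ * f)]mulrA Ej.
  by ring.
rewrite step (IHj (ltnW lt_jn)) raddf_sum mulr_sumr scaler_sumr -sumrB /=.
pose S l := mobius_subst (n - l) q^`(l).
transitivity (\sum_(l < j.+1) (c * ((n - l)%:R - j%:R) * deriv_weight n j l) *: S l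
    + \sum_(l < j.+1) deriv_weight n j l *: S l.+1).
  rewrite -big_split /=; apply: eq_bigr => l _.
  have dS : den * (S l)^`() = (c *+ (n - l)) *: S l + S l.+1.
    have gt0_nl : (0 < n - l)%N by rewrite subn_gt0 (leq_trans (ltn_ord l)).
    rewrite /S subnS derivnS; move: (n - l)%N gt0_nl => [|m] // _.
    exact: deriv_mobius_subst.
  rewrite derivZ -scalerAr -/(S l) dS scalerDr.
  rewrite [LHS]addrAC !scalerA -scalerBl; congr (_ *: _ + _).
  by ring.
rewrite [in RHS]big_ord_recl /= addr0.
under [X in _ = _ + X]eq_bigr do rewrite scalerDl.
rewrite big_split /= addrA; congr (_ + _).
rewrite [X in _ = _ + X]big_ord_recr /= (@deriv_weight_gt _ _ _ (ltnSn j)).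
by rewrite mulr0 scale0r addr0 big_ord_recl.
Qed.

(** By [derivn_mobius_subst], scaling column j of the transformed Wronskian
    matrix by u^j yields the matrix on the right times a unitriangular one. *)
Lemma wronskian_mobius_subst n k (p : 'I_k -> {poly K}) : (k <= n.+1)%N ->
  (\prod_(j < k) den ^+ j) * wronskian (fun i => mobius_subst n (p i)) =
  \det (\matrix_(i < k, l < k) mobius_subst (n - l) (p i)^`(l)).
Proof.
move=> le_kn; set N := \matrix_(i, l) mobius_subst (n - l) _.
pose D : 'rV[{poly K}]_k := \row_j den ^+ j.
pose T : 'M[{poly K}]_k := \matrix_(l, j) (deriv_weight n j l)%:P.
have factor : (\matrix_(i, j) (mobius_subst n (p i))^`(j)) *m diag_mx D = N *m T.
  apply/matrixP=> i j; rewrite mul_mx_diag !mxE mulrC.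
  rewrite derivn_mobius_subst; last by rewrite -ltnS (leq_trans (ltn_ord j)).
  rewrite (big_ord_widen k (fun l =>
    deriv_weight n j l *: mobius_subst (n - l) (p i)^`(l))) //.
  rewrite big_mkcond /=; apply: eq_bigr => l _; rewrite !mxE mulrC mul_polyC.
  by case: leqP => // /deriv_weight_gt ->; rewrite scale0r.
have detT : \det T = 1.
  rewrite -det_tr det_trig; last first.
    by apply/is_trig_mxP => i j lt_ij; rewrite !mxE deriv_weight_gt.
  by apply: big1 => i _; rewrite !mxE deriv_weight_diag.
move/(congr1 determinant): factor; rewrite !det_mulmx detT mulr1 => <-.
rewrite det_diag mulrC; congr (_ * _).
by apply: eq_bigr => j _; rewrite mxE.
Qed.

(** Column l on the right of [wronskian_mobius_subst], evaluated at z, carries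
    a factor u^(n - l). Since n - (k - 1 - l) = (n + 1 - k) + l, reversing the
    order of the columns shows that these factors multiply up to u^(k(n+1-k))
    times the product of the u^j on the left, which then cancels. *)
Lemma horner_wronskian_mobius_subst n k (p : 'I_k -> {poly K}) z :
    (k <= n.+1)%N -> (forall i, (size (p i) <= n.+1)%N) -> c * z + d != 0 ->
  (wronskian (fun i => mobius_subst n (p i))).[z] =
  (c * z + d) ^+ (k * (n.+1 - k))
  * (wronskian p).[(a * z + b) / (c * z + d)].
Proof.
move=> le_kn le_pn nz; set u := c * z + d; set w := _ / _.
have den_z : den.[z] = u by rewrite !hornerE.
have prod_nz : \prod_(j < k) u ^+ j != 0.
  by apply/prodf_neq0 => j _; rewrite expf_neq0.
apply: (mulfI prod_nz).
have := congr1 (horner^~ z) (wronskian_mobius_subst _ _ p le_kn).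
rewrite hornerM horner_prod.
under eq_bigr do rewrite horner_exp den_z.
move=> ->.
pose P : 'M[K]_k := \matrix_(i, j) ((p i)^`(j)).[w].
have wP : (wronskian p).[w] = \det P.
  rewrite -horner_evalE -det_map_mx; congr (\det _).
  by apply/matrixP=> i j; rewrite !mxE.
rewrite wP -horner_evalE -det_map_mx.
have -> : map_mx (horner_eval z)
    (\matrix_(i < k, l < k) mobius_subst (n - l) (p i)^`(l)) =
    P *m diag_mx (\row_l u ^+ (n - l)).
  apply/matrixP=> i l; rewrite mul_mx_diag !mxE mulrC.
  apply: horner_mobius_subst => //; apply: leq_trans (size_derivn_leq _ _ _) _.
  by have := ltn_ord l; have := le_pn i; lia.
rewrite det_mulmx det_diag [LHS]mulrC mulrA; congr (_ * _).
have -> : u ^+ (k * (n.+1 - k)) = \prod_(j < k) u ^+ (n.+1 - k).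
  by rewrite prodr_const card_ord -exprM mulnC.
rewrite -big_split [RHS](reindex_inj rev_ord_inj) /=.
apply: eq_bigr => l _; rewrite mxE -exprD; congr (_ ^+ _).
by have := ltn_ord l; lia.
Qed.
End Homogenization.

(** Multiplying p - q by c 'X + d makes it vanish everywhere, and a nonzero
    polynomial has finitely many roots. *)
Lemma poly_eq_off_affine_root (K : numFieldType) (c d : K) (p q : {poly K}) :
    (c != 0) || (d != 0) ->
    (forall z, c * z + d != 0 -> p.[z] = q.[z]) ->
  p = q.
Proof.
move=> cd0 eq_pq; pose r := (p - q) * (c *: 'X + d%:P).
have rE z : r.[z] = 0.
  rewrite !hornerE; have [->|/eq_pq ->] := eqVneq (c * z + d) 0.
    by rewrite mulr0.
  by rewrite subrr mul0r.
have r0 : r = 0.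
  apply: (@roots_geq_poly_eq0 _ _ [seq j%:R | j <- iota 0 (size r)]).
  - by apply/allP => z _; apply/eqP.
  - rewrite map_inj_uniq ?iota_uniq //.
    by move=> i j /eqP; rewrite Num.Theory.eqr_nat => /eqP.
  - by rewrite size_map size_iota.
move/eqP: r0; rewrite mulf_eq0 subr_eq0 => /orP[/eqP //|/eqP den0].
have := congr1 (fun s : {poly K} => (s`_1, s`_0)) den0.
rewrite !coefD !coefZ !coefX !coefC /= !mulr1 mulr0 add0r addr0 => -[c0 d0].
by move: cd0; rewrite c0 d0 eqxx.
Qed.

Theorem theorem4p3 (R : realType) (n k : nat) (hk : (1 <= k <= n.+1)%N)
    (a b c d : R[i]) (hdet : a * d - b * c = 1) :
  (forall x : extpow {poly_n.+1 R[i]} k,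
     ext_wronskian R[i] n k (ext_map k (sl2_act n a b c d) x)
     = sl2_act (k * (n.+1 - k))%N a b c d (ext_wronskian R[i] n k x))
  /\
  (forall p phat : 'I_k -> {poly_n.+1 R[i]},
     (forall i z, c * z + d != 0 ->
        (phat i).[z] = (c * z + d) ^+ n * (p i).[(a * z + b) / (c * z + d)]) ->
     forall z, c * z + d != 0 ->
       (wronskian (fun i => phat i : {poly R[i]})).[z]
       = (c * z + d) ^+ (k * (n.+1 - k))
         * (wronskian (fun i => p i : {poly R[i]})).[(a * z + b) / (c * z + d)]).
Proof.
have /andP[_ le_kn] := hk.
have cd0 : (c != 0) || (d != 0).
  rewrite -negb_and; apply/negP => /andP[/eqP c0 /eqP d0].
  by move/eqP: hdet; rewrite c0 d0 !mulr0 subrr eq_sym oner_eq0.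
have pointwise (p phat : 'I_k -> {poly_n.+1 R[i]}) :
    (forall i z, c * z + d != 0 ->
        (phat i).[z] = (c * z + d) ^+ n * (p i).[(a * z + b) / (c * z + d)]) ->
     forall z, c * z + d != 0 ->
       (wronskian (fun i => phat i : {poly R[i]})).[z]
       = (c * z + d) ^+ (k * (n.+1 - k))
         * (wronskian (fun i => p i : {poly R[i]})).[(a * z + b) / (c * z + d)].
  move=> eq_phat z nz.
  have phatE i : phat i = mobius_subst a b c d n (p i) :> {poly R[i]}.
    apply: (poly_eq_off_affine_root _ c d) => // y ny.
    by rewrite eq_phat // horner_mobius_subst // size_npoly.
  rewrite -horner_wronskian_mobius_subst //.
  by congr (\det _).[z]; apply/matrixP=> i j; rewrite !mxE phatE.
split; last exact: pointwise.
apply: (@eq_on_wedge _ _ _ _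
  (ext_wronskian R[i] n k \o ext_map k (sl2_act n a b c d))
  (sl2_act (k * (n.+1 - k)) a b c d \o ext_wronskian R[i] n k)) => v.
apply: val_inj; apply: (poly_eq_off_affine_root _ c d) => // z nz /=.
rewrite ext_mapE ext_wronskianE horner_sl2_act // ext_wronskianE.
apply: pointwise => // i y ny; rewrite ffunE.
exact: horner_sl2_act.
Qed.
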